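(* Let $f\in(3')$ be as in the context, and let $g=m(s,s')-m(s',s)$ with $s,s'\in\Sigma$, $s>s'$, $m_{ss'}<\infty$, so $\bar g=m(s,s')$. Let $0\le i\le k$ and suppose $$\bar f=u_0\cdots u_{i-1}\,(m-2)(s_i,s'_i)\,\bar g\,(m-2)(s'_{i+1},s_{i+1})\,u_{i+2}\cdots u_{k+1}y_{k+1},$$ where $u_0\cdots u_{i-1}=1$ if $i=0$ and $u_{i+2}\cdots u_{k+1}=1$ if $i=k$. Let $(f,g)_{\bar f}$ be the inclusion composition for this occurrence of $\bar g$. Then: (i) $g=x_is_{i+1}-s_{i+1}x_i$ and $x_i>s_{i+1}$. (ii) $(f,g)_{\bar f}\equiv0$ if $|u_i|=1$ or $|u_{i+1}|=1$. (iii) If $|u_i|>1$ and $|u_{i+1}|>1$, then $$(f,g)_{\bar f}\equiv u_0\cdots u_{i-1}(m-2)(s_i,s'_i)s_{i+1}x_i\,(m-2)(s'_{i+1},s_{i+1})u_{i+2}\cdots u_{k+1}y_{k+1}-s'_0u_0\cdots u_{k+1}.$$ Here $\equiv$ is congruence modulo $(S,\bar f)$.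
   Context: Coxeter setting. $\Sigma=\{\sigma_1,\dots,\sigma_n\}$ is finite, $(m_{ij})$ is a Coxeter matrix (symmetric, $m_{ii}=1$, $2\le m_{ij}\le\infty$ for $i\neq j$); for $s=\sigma_i,s'=\sigma_j$ write $m_{ss'}=m_{ij}$. $\Sigma^*$ is the free monoid (empty word $1$) with the deg-lex ordering (length first, then lexicographic with $\sigma_1<\dots<\sigma_n$); $|u|$ is word length; $\bar f$ is the largest word of $f\in F\langle\Sigma\rangle$, $F$ a field. For finite $m_{ss'}$, $m(s,s')$ is the alternating word $ss's\cdots$ of length $m_{ss'}$ and $(m-t)(s,s')$ the alternating word $ss's\cdots$ of length $m_{ss'}-t$ ($m$ refers to the pair in parentheses). $S$ is the union of: $(1)$ all $s^2-1$, $s\in\Sigma$; $(2)$ all $m(s,s')-m(s',s)$, $s>s'$, $m_{ss'}<\infty$; $(3')$ all $(m-1)(s_0,s_0')\cdots(m-1)(s_k,s_k')m(s_{k+1},s'_{k+1})-m(s'_0,s_0)(m-1)(s_1,s_1')\cdots(m-1)(s_{k+1},s'_{k+1})$ with $k\ge0$, $s_j,s_j'\in\Sigma$, all $m_{s_js_j'}$ finite, where for $0\le j\le k$: $s'_{j+1}=s'_j$ if $m_{s_js'_j}$ is even, $s'_{j+1}=s_j$ if it is odd; $s_0>s'_0$, $s_j<s'_j$ for $1\le j\le k+1$; $\{s_j,s'_j\}\ne\{s_{j+1},s'_{j+1}\}$ for $0\le j\le k$. Notation. $f\in(3')$ has data $s_j,s'_j$ $(0\le j\le k+1)$; $u_j=(m-1)(s_j,s'_j)$,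 $x_j$ is the last letter of $u_j$, $y_j$ the last letter of $m(s_j,s_j')$. Thus $f=u_0\cdots u_{k+1}y_{k+1}-s'_0u_0\cdots u_{k+1}$ and $\bar f=u_0\cdots u_{k+1}y_{k+1}$. If $\bar f=a\bar gb$, the inclusion composition is $(f,g)_{\bar f}=f-agb$. $h\equiv h'$ modulo $(S,\bar f)$ means $h-h'=\sum\alpha_ra_rs_rb_r$ with $\alpha_r\in F$, $s_r\in S$, $a_r,b_r\in\Sigma^*$, $a_r\overline{s_r}b_r<\bar f$. *)

(* Defs.v *)
From HB Require Import structures.
From mathcomp Require Import all_boot all_order all_algebra.
From mathcomp Require Import finmap.
From mathcomp.multinomials Require Import monalg.

Set Implicit Arguments.
Unset Strict Implicit.
Unset Printing Implicit Defensive.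

Import Order.TTheory GRing.Theory.
Local Open Scope ring_scope.

(* The free associative algebra F<Sigma> on Sigma = 'I_n is the monoid algebra
   of the free monoid {fmonom 'I_n}.  Words are handled as plain sequences:
   {fmonom 'I_n} is a wrapper around seq 'I_n whose product is ++. *)
Notation word n := (seq 'I_n).
Notation freealg F n := {malg F[{fmonom 'I_n}]}.

Definition mon (F : fieldType) (n : nat) (w : word n) : freealg F n :=
  << FMonom w >>.
Arguments mon F {n} w.

Section DegLex.
Variable n : nat.

(* seqlexi is the lexicographic order for the order 0 < 1 < ... of 'I_n. *)
Definition deglex (u v : word n) : bool :=
  (size u < size v)%N ||
  ((size u == size v) && (u < v :> seqlexi 'I_n)%O).

Definition deglex_max (u v : word n) : word n := if deglex u v then v else u.

(* Junk value: the leading word of 0 is the empty word. *)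
Definition lead (F : fieldType) (f : freealg F n) : word n :=
  \big[deglex_max/[::]]_(w <- msupp f) (w : word n).

End DegLex.

Section Composition.
Variables (F : fieldType) (n : nat).

(* Meaningful when lead f = a ++ lead g ++ b. *)
Definition inclusion_composition (f g : freealg F n) (a b : word n) :
  freealg F n := f - mon F a * g * mon F b.

Definition congr_mod (S : freealg F n -> Prop) (w : word n)
    (h h' : freealg F n) : Prop :=
  exists (N : nat) (alpha : 'I_N -> F) (a b : 'I_N -> word n)
         (r : 'I_N -> freealg F n),
    [/\ forall l, S (r l),
        forall l, deglex (a l ++ lead (r l) ++ b l) w
      & h - h' = \sum_(l < N) alpha l *: (mon F (a l) * r l * mon F (b l))].

End Composition.

Section Coxeter.
Variables (n : nat).

(* None stands for infinity. *)
Implicit Type m : 'I_n -> 'I_n -> option nat.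

Definition is_coxeter_matrix m : Prop :=
  [/\ forall i j, m i j = m j i,
      forall i, m i i = Some 1%N
    & forall i j d, i != j -> m i j = Some d -> (2 <= d)%N].

Fixpoint alternating (l : nat) (s s' : 'I_n) : word n :=
  if l is l'.+1 then s :: alternating l' s' s else [::].

(* The word (m - t)(s, s'); only meaningful when m s s' is finite. *)
Definition altm m (t : nat) (s s' : 'I_n) : word n :=
  alternating (odflt 0%N (m s s') - t)%N s s'.

Definition uword m (s s' : nat -> 'I_n) (j : nat) : word n :=
  altm m 1 (s j) (s' j).

(* uprod m s s' i j = u_i u_(i+1) ... u_(j-1), empty if j <= i *)
Definition uprod m (s s' : nat -> 'I_n) (i j : nat) : word n :=
  \big[cat/[::]]_(i <= l < j) uword m s s' l.

(* The words are nonempty under chain_data, so the default s j is not used. *)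
Definition xletter m (s s' : nat -> 'I_n) (j : nat) : 'I_n :=
  last (s j) (uword m s s' j).
Definition yletter m (s s' : nat -> 'I_n) (j : nat) : 'I_n :=
  last (s j) (altm m 0 (s j) (s' j)).

(* Only the values of s and s' at the indices 0, ..., k + 1 matter. *)
Definition chain_data m (k : nat) (s s' : nat -> 'I_n) : Prop :=
  [/\ forall j, (j <= k.+1)%N -> m (s j) (s' j) != None,
      forall j d, (j <= k)%N -> m (s j) (s' j) = Some d ->
        s' j.+1 = if odd d then s j else s' j,
      (s' 0%N < s 0%N)%N,
      forall j, (1 <= j <= k.+1)%N -> (s j < s' j)%N
    & forall j, (j <= k)%N ->
        [set s j; s' j] != [set s j.+1; s' j.+1]].

Variable F : fieldType.

Definition braid_rel m (s s' : 'I_n) : freealg F n :=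
  mon F (altm m 0 s s') - mon F (altm m 0 s' s).

Definition chain_rel m (k : nat) (s s' : nat -> 'I_n) : freealg F n :=
  mon F (uprod m s s' 0 k.+1 ++ altm m 0 (s k.+1) (s' k.+1))
  - mon F (altm m 0 (s' 0%N) (s 0%N) ++ uprod m s s' 1 k.+2).

Inductive coxeter_S m : freealg F n -> Prop :=
  | S_square s : coxeter_S m (mon F [:: s; s] - 1)
  | S_braid (s s' : 'I_n) of (s' < s)%N & m s s' != None :
      coxeter_S m (braid_rel m s s')
  | S_chain k s s' of chain_data m k s s' :
      coxeter_S m (chain_rel m k s s').

End Coxeter.
Arguments braid_rel {n} F m s s'.
Arguments chain_rel {n} F m k s s'.
Arguments coxeter_S {n} F m _.

(* Main.v *)
Require Import Defs.
From HB Require Import structures.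
From mathcomp Require Import all_boot all_order all_algebra.
From mathcomp Require Import finmap.
From mathcomp.multinomials Require Import monalg.
From mathcomp Require Import zify.

Set Implicit Arguments.
Unset Strict Implicit.
Unset Printing Implicit Defensive.

Import Order.TTheory GRing.Theory.
Local Open Scope ring_scope.

(** Let [c = s_(i+1)] and [P = u_0 ... u_(i-1)].  The leading word of the chain
    relation splits as [P (m-2)(s_i, s'_i) x_i c (m-2)(s'_(i+1), c) ...], so the
    hypothesis on the occurrence forces the leading word of [g] to be [x_i c]:
    this is (i), and [x_i] commutes with [c].  The composition is then literally
    the difference of the two words in (iii), so (iii) is an equality.

    For (ii), the two words must be joined by relations applied inside words
    smaller than [W], the leading word of [f].  Two remarks make the order
    condition almost invisible.  A word of length at most that of [W] is below
    [W] as soon as it starts like [W] up to a place where it has a smaller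
    letter; hence below a fixed small prefix any braid moves may be performed
    freely (predicate [below], lemma [braid_equiv_congr]).  Secondly, the
    relevant prefixes are [s'_0], since [W] starts with the larger [s_0], and
    [P c], since [W] starts with [P s_i] and [c] is smaller than both [s_i] and
    [s'_i].

    If [u_i] or [u_(i+1)] is a single letter, all letters of [u_i] commute with
    all letters of [u_(i+1)] ([overlap_commute]).  With [R = u_(i+2) ... u_(k+1)]
    this turns the first word into [P u_(i+1) u_i R y_(k+1)] and the second one
    into [s'_0 P u_(i+1) u_i R].  It remains to carry the letter [s'_0] from left
    to right.  Passing [P u_(i+1)] is the heart of the matter ([chain_push]):
    for [i > 0], braid moves would run through the word [P s'_i ...], which is
    above [W], and one uses instead the chain relation whose pairs are those of
    [f] up to [i - 1] followed by the pair [(c, s'_i)] (a single braid relation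
    if [i = 0]).  That is a legitimate chain unless
    [{c, s'_i} = {s_(i-1), s'_(i-1)}]; but then [u_(i+1)] is the reversal of
    [u_(i-1)], the two cancel by the relations [s^2 = 1], and between shorter
    words everything is allowed.  The remaining factors [u_i] and [R] are passed
    by braid moves below the prefix [P c] ([overlap_exchange], [chain_pass]). *)

(** * The deg-lex order *)

Section DegLexTheory.
Variable n : nat.
Implicit Types (p q v w P T W : word n) (c d : 'I_n) (N : nat).

Lemma deglex_irr w : deglex w w = false.
Proof. by rewrite /deglex ltnn eqxx ltxx. Qed.

Lemma deglex_asym v w : deglex v w -> deglex w v = false.
Proof.
rewrite /deglex; case: ltngtP => //= _ lt_vw.
by apply: contraTF lt_vw => /ltW lt_wv; rewrite -leNgt.
Qed.

Lemma deglex_size v w : deglex v w -> (size v <= size w)%N.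
Proof. by rewrite /deglex; case: ltngtP. Qed.

Lemma deglex_short v w : (size v < size w)%N -> deglex v w.
Proof. by rewrite /deglex => ->. Qed.

(** Lengths may drop after the branching letter: a shorter word is smaller. *)
Lemma deglex_branch P c d v w :
  (c < d)%N -> (size v <= size w)%N -> deglex (P ++ c :: v) (P ++ d :: w).
Proof.
move=> lt_cd; rewrite leq_eqVlt => /orP[/eqP eq_vw | lt_vw]; last first.
  by apply: deglex_short; rewrite !size_cat /= ltn_add2l ltnS.
rewrite /deglex !size_cat /= eq_vw ltnn eqxx /=.
elim: P => [|e P IH] /=; rewrite Order.SeqLexiOrder.Exports.ltxi_cons.
  by rewrite !leEord (ltnW lt_cd) leqNgt lt_cd.
by rewrite lexx.
Qed.

(** The prefix [P] alone puts a word below [W], as long as what follows [P] has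
    length at most [N]; such a prefix leaves its right context free to vary. *)
Definition below W P N := forall T, (size T <= N)%N -> deglex (P ++ T) W.

Lemma below_branch P c d w N :
  (c < d)%N -> (N <= size w)%N -> below (P ++ d :: w) (rcons P c) N.
Proof.
by move=> lt_cd le_N T le_T; rewrite cat_rcons deglex_branch // (leq_trans le_T).
Qed.

Lemma below_short W N : (N < size W)%N -> below W [::] N.
Proof. by move=> lt_N T le_T; apply: deglex_short; apply: leq_ltn_trans lt_N. Qed.

Lemma below_le W P N M : below W P M -> (N <= M)%N -> below W P N.
Proof. by move=> hP le_M T le_T; apply/hP/(leq_trans le_T). Qed.

Lemma below_cat W P v N M :
  below W P M -> (size v + N <= M)%N -> below W (P ++ v) N.
Proof.
move=> hP le_M T le_T; rewrite -catA; apply: hP; rewrite size_cat.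
by apply: leq_trans le_M; rewrite leq_add2l.
Qed.

(** [lead] is a fold over an unspecified enumeration of the support, so the
    induction must also bound the fold over parts that miss [p]. *)
Lemma big_deglex_max p (r : seq (word n)) :
  p \in r -> {in r, forall w, (w == p) || deglex w p} ->
  \big[deglex_max (n:=n)/[::]]_(w <- r) w = p.
Proof.
move=> r_p le_p.
suff [_ ->] : let z := \big[deglex_max (n:=n)/[::]]_(w <- r) w in
    (z = p \/ deglex z p) /\ (p \in r -> z = p) by [].
have deglex_nil : [::] = p \/ deglex [::] p.
  by case: (p) => [|c p']; [left | right].
elim: r le_p {r_p} => [|w r IH] le_p /=; first by rewrite big_nil.
rewrite big_cons /deglex_max inE.
have [|le_z eq_z] := IH; first by move=> v r_v; apply: le_p; rewrite inE r_v orbT.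
have := le_p w (mem_head _ _); case: eqP => [-> _ | ne_w /= lt_w].
  rewrite eqxx /=; case: ifP => [lt_pz|_]; last by split=> //; left.
  by case: le_z lt_pz => [->|/deglex_asym ->] //; rewrite deglex_irr.
rewrite eq_sym (introF eqP ne_w) /=; split=> [|/eq_z ->]; last by rewrite lt_w.
by case: ifP => _; [exact: le_z | right].
Qed.

Section Lead.
Variable F : fieldType.

Lemma mon_nil : mon F [::] = 1 :> freealg F n.
Proof. by rewrite /mon -fmoneE. Qed.

Lemma mon_cat v w : mon F (v ++ w) = mon F v * mon F w.
Proof. by rewrite /mon malgM_def fgmulUU mulr1
  -(fmmulE (FMonom v) (FMonom w) : _ = FMonom (v ++ w)). Qed.

Lemma lead_monB p q : deglex q p -> lead (mon F p - mon F q) = p.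
Proof.
move=> lt_qp.
have ne_pq : FMonom p != FMonom q.
  by apply: contraTneq lt_qp => -[->]; rewrite deglex_irr.
have memE (x : {fmonom 'I_n}) :
    (x \in msupp (mon F p - mon F q)) = (x \in [:: FMonom p; FMonom q]).
  rewrite msuppB ?msuppU1; last by rewrite fdisjointX1 !inE eq_sym.
  by rewrite !inE.
rewrite /lead -(big_map (@fmonom_val 'I_n) xpredT id) /=.
apply: big_deglex_max.
  apply/mapP; exists (FMonom p) => //.
  by have := memE (FMonom p); rewrite inE eqxx => ->.
move=> _ /mapP[x /= mem_x ->]; move: mem_x; rewrite memE !inE.
by case/orP => /eqP ->; apply/orP; [left | right].
Qed.

End Lead.
End DegLexTheory.

(** * Congruence modulo a set of relations *)

(** This and the next identity are stated over abstract structures because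
    rewriting with ring axioms inside [freealg] unfolds the convolution
    product. *)
Lemma mulrB_sandwich (R : pzRingType) (a b p q : R) :
  a * (p - q) * b = a * (p * b) - a * (q * b).
Proof. by rewrite mulrBr mulrBl !mulrA. Qed.

Lemma subrBB_cancel (R : zmodType) (p q r : R) : p - q - (p - r) = r - q.
Proof. by rewrite opprB addrC subrKA. Qed.

Section Congruence.
Variables (F : fieldType) (n : nat) (S : freealg F n -> Prop) (W : word n).
Implicit Types (h : freealg F n) (A B p q : word n).

Lemma congr_mod_refl h : congr_mod S W h h.
Proof.
exists 0%N, (fun _ => 0), (fun _ => [::]), (fun _ => [::]), (fun _ => 0).
by split=> [[]|[]|] //; rewrite subrr big_ord0.
Qed.

Lemma congr_mod_sym h h' : congr_mod S W h h' -> congr_mod S W h' h.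
Proof.
move=> [N [al [a [b [r [Sr lt_r eq_h]]]]]].
exists N, (fun l => - al l), a, b, r; split; [exact: Sr | exact: lt_r |].
by rewrite -opprB eq_h -sumrN; apply: eq_bigr => l _; rewrite scaleNr.
Qed.

Lemma congr_mod_trans h2 h1 h3 :
  congr_mod S W h1 h2 -> congr_mod S W h2 h3 -> congr_mod S W h1 h3.
Proof.
move=> [N [al [a [b [r [Sr lt_r eq_h]]]]]].
move=> [M [al' [a' [b' [r' [Sr' lt_r' eq_h']]]]]].
pose glue T (f : 'I_N -> T) (g : 'I_M -> T) (l : 'I_(N + M)) :=
  match split l with inl i => f i | inr j => g j end.
exists (N + M)%N, (glue _ al al'), (glue _ a a'), (glue _ b b'), (glue _ r r').
split=> [l|l|]; rewrite /glue; try by case: (split l).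
rewrite -[LHS](subrKA h2) eq_h eq_h' big_split_ord /=.
apply: f_equal2; apply: eq_bigr => l _.
  by rewrite (unsplitK (inl l)).
by rewrite (unsplitK (inr l)).
Qed.

Lemma congr_mod_subr0 h h' : congr_mod S W h h' -> congr_mod S W (h - h') 0.
Proof. by rewrite /congr_mod subr0. Qed.

(** The source of all congruences: one relation, applied once inside a word. *)
Lemma congr_mod_step p q A B : S (mon F p - mon F q) -> deglex q p ->
  deglex (A ++ p ++ B) W ->
  congr_mod S W (mon F (A ++ p ++ B)) (mon F (A ++ q ++ B)).
Proof.
move=> Spq lt_qp lt_W.
exists 1%N, (fun _ => 1), (fun _ => A), (fun _ => B), (fun _ => mon F p - mon F q).
split=> // [_|]; first by rewrite lead_monB.
by rewrite big_ord1 scale1r !mon_cat mulrB_sandwich.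
Qed.

End Congruence.

(** * Alternating words and braid moves *)

Section Alternating.
Variables (n : nat) (m : 'I_n -> 'I_n -> option nat).
Hypothesis hm : is_coxeter_matrix m.
Implicit Types (c d e : 'I_n) (l : nat).

Lemma size_alternating l c d : size (alternating l c d) = l.
Proof. by elim: l c d => //= l IH c d; rewrite IH. Qed.

Lemma alternatingSr l c d :
  alternating l.+1 c d = rcons (alternating l c d) (if odd l then d else c).
Proof. by elim: l c d => //= l IH c d; have /= -> := IH d c; case: odd. Qed.

Lemma rev_alternating l c d :
  rev (alternating l c d) = if odd l then alternating l c d else alternating l d c.
Proof.
elim: l c d => // l IH c d.
by rewrite [in LHS]alternatingSr rev_rcons IH /=; case: (odd l).
Qed.

Lemma mem_alternating l c d e : e \in alternating l c d -> e = c \/ e = d.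
Proof.
by elim: l c d => [|l IH] c d //=; rewrite inE => /orP[/eqP ->|/IH[] ->]; auto.
Qed.

(** The last letter of [m(c, d)]; exchanging [c] and [d] gives the last letter of
    [(m-1)(c, d)], whatever the parity. *)
Definition braid_last c d : 'I_n := if odd (odflt 0%N (m c d)) then c else d.

Lemma braid_last_mem c d : braid_last c d = c \/ braid_last c d = d.
Proof. by rewrite /braid_last; case: odd; [left | right]. Qed.

Lemma coxeter_ge2 c d : c != d -> m c d != None ->
  exists r, m c d = Some r.+2.
Proof.
have [_ _ ge2] := hm.
move=> ne_cd; case E: (m c d) => [r|] // _.
by have := ge2 _ _ _ ne_cd E; case: r E => [|[|r]] // E; exists r.
Qed.

Lemma altmE t r c d : m c d = Some (t + r)%N -> altm m t c d = alternating r c d.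
Proof. by rewrite /altm => -> /=; rewrite addKn. Qed.

Lemma altm0_pair c d e e' : altm m 0 c d = [:: e; e'] ->
  [/\ m c d = Some 2%N, c = e & d = e'].
Proof. by rewrite /altm; case: (m c d) => [[|[|[|r]]]|] //= [-> ->]. Qed.

Lemma altm0_rcons c d : c != d -> m c d != None ->
  altm m 0 c d = rcons (altm m 1 c d) (braid_last c d).
Proof.
move=> ne_cd fin_cd; have [r E] := coxeter_ge2 ne_cd fin_cd.
rewrite (@altmE 0 r.+2) // (@altmE 1 r.+1) // alternatingSr /braid_last E /=.
by case: (odd r).
Qed.

Lemma altm0_cons c d : c != d -> m c d != None ->
  altm m 0 d c = d :: altm m 1 c d.
Proof.
move=> ne_cd fin_cd; have [r E] := coxeter_ge2 ne_cd fin_cd.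
have [sym _ _] := hm.
by rewrite (@altmE 0 r.+2) 1?sym // (@altmE 1 r.+1).
Qed.

Lemma altm1_rcons c d : c != d -> m c d != None ->
  altm m 1 c d = rcons (altm m 2 c d) (braid_last d c).
Proof.
move=> ne_cd fin_cd; have [r E] := coxeter_ge2 ne_cd fin_cd.
have [sym _ _] := hm.
rewrite (@altmE 1 r.+1) // (@altmE 2 r) // alternatingSr /braid_last sym E /=.
by case: (odd r).
Qed.

Lemma altm1_cons c d : c != d -> m c d != None ->
  altm m 1 c d = c :: altm m 2 d c.
Proof.
move=> ne_cd fin_cd; have [r E] := coxeter_ge2 ne_cd fin_cd.
have [sym _ _] := hm.
by rewrite (@altmE 1 r.+1) // (@altmE 2 r) // sym.
Qed.

(** Read backwards, [(m-1)(c, d)] is again of the form [(m-1)(e, e')] with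
    [{e, e'} = {c, d}], and the letter completing it to [m(e, e')] is [d]. *)
Lemma altm_rev c d : c != d -> m c d != None ->
  altm m 1 (braid_last d c) (braid_last c d) = rev (altm m 1 c d) /\
  braid_last (braid_last d c) (braid_last c d) = d.
Proof.
move=> ne_cd fin_cd; have [r E] := coxeter_ge2 ne_cd fin_cd.
have [sym _ _] := hm.
rewrite (@altmE 1 r.+1 c d) // rev_alternating /braid_last [m d c]sym E /= negbK.
case odd_r: (odd r) => /=; rewrite ?[m d c]sym E /= odd_r /=; split=> //.
  by rewrite (@altmE 1 r.+1) // sym.
by rewrite (@altmE 1 r.+1).
Qed.

End Alternating.

Section BraidEquivalence.
Variables (n : nat) (m : 'I_n -> 'I_n -> option nat).
Hypothesis hm : is_coxeter_matrix m.
Implicit Types (c d e : 'I_n) (v w : word n).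

(** Equality in the Artin monoid of [m]: no squares are cancelled, hence lengths
    are preserved. *)
Inductive braid_equiv : word n -> word n -> Prop :=
  | braid_refl v : braid_equiv v v
  | braid_sym v w of braid_equiv v w : braid_equiv w v
  | braid_trans v2 v1 v3 of braid_equiv v1 v2 & braid_equiv v2 v3 :
      braid_equiv v1 v3
  | braid_cat v v' w w' of braid_equiv v v' & braid_equiv w w' :
      braid_equiv (v ++ w) (v' ++ w')
  | braid_move c d of m c d != None :
      braid_equiv (altm m 0 c d) (altm m 0 d c).

Lemma braid_equiv_size v w : braid_equiv v w -> size v = size w.
Proof.
elim=> [//|//|v2 v1 v3 _ -> _ //|v1 v2 w1 w2 _ eq_v _ eq_w|c d _].
  by rewrite !size_cat eq_v eq_w.
by have [sym _ _] := hm; rewrite !size_alternating sym.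
Qed.

Lemma braid_catl v w w' : braid_equiv w w' -> braid_equiv (v ++ w) (v ++ w').
Proof. exact/braid_cat/braid_refl. Qed.

Lemma braid_catr v v' w : braid_equiv v v' -> braid_equiv (v ++ w) (v' ++ w).
Proof. by move=> eq_v; apply: braid_cat eq_v (braid_refl _). Qed.

(** A letter [d] can cross [(m-1)(c, d)], because [d (m-1)(c, d) = m(d, c)]; it
    comes out as the last letter of [m(c, d)]. *)
Lemma braid_pass c d : c != d -> m c d != None ->
  braid_equiv (d :: altm m 1 c d) (rcons (altm m 1 c d) (braid_last m c d)).
Proof.
move=> ne_cd fin_cd; rewrite -altm0_rcons // -altm0_cons //.
by apply/braid_sym/braid_move.
Qed.

Lemma braid_commute c d : m c d = Some 2%N -> braid_equiv [:: c; d] [:: d; c].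
Proof.
move=> E; have [sym _ _] := hm.
by have := @braid_move c d; rewrite /altm [m d c]sym E; apply.
Qed.

Lemma braid_commute_word c v : {in v, forall d, m c d = Some 2%N} ->
  braid_equiv (c :: v) (rcons v c).
Proof.
elim: v => [|d v IH] com /=; first exact: braid_refl.
apply: (@braid_trans [:: d, c & v]).
  exact: (braid_catr v (braid_commute (com d (mem_head _ _)))).
by apply: (braid_catl [:: d]); apply: IH => e v_e; apply: com; rewrite inE v_e orbT.
Qed.

Lemma braid_commute_words v w :
  {in v & w, forall c d, m c d = Some 2%N} -> braid_equiv (v ++ w) (w ++ v).
Proof.
elim: v => [|c v IH] com /=; first by rewrite cats0; apply: braid_refl.
apply: (@braid_trans (c :: w ++ v)).
  apply: (braid_catl [:: c]); apply: IH => d e v_d.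
  by apply: com; rewrite inE v_d orbT.
rewrite -cat_rcons; apply: (@braid_catr (c :: w) (rcons w c) v).
by apply: braid_commute_word => d w_d; apply: com; rewrite // mem_head.
Qed.

End BraidEquivalence.

(** * Reductions below a word *)

Section Reduction.
Variables (F : fieldType) (n : nat) (m : 'I_n -> 'I_n -> option nat).
Hypothesis hm : is_coxeter_matrix m.
Implicit Types (c d e : 'I_n) (v w A B P T W : word n).

Definition word_congr W v w := congr_mod (coxeter_S F m) W (mon F v) (mon F w).

Lemma word_congr_refl W v : word_congr W v v.
Proof. exact: congr_mod_refl. Qed.

Lemma word_congr_sym W v w : word_congr W v w -> word_congr W w v.
Proof. exact: congr_mod_sym. Qed.

Lemma word_congr_trans W v2 v1 v3 :
  word_congr W v1 v2 -> word_congr W v2 v3 -> word_congr W v1 v3.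
Proof. exact: congr_mod_trans. Qed.

Lemma braid_deglex c d : (d < c)%N -> m c d != None ->
  deglex (altm m 0 d c) (altm m 0 c d).
Proof.
move=> lt_dc fin_cd; have ne_dc : d != c by rewrite neq_ltn lt_dc.
have fin_dc : m d c != None by have [sym _ _] := hm; rewrite sym.
rewrite (altm0_cons hm ne_dc fin_dc) altm0_cons // 1?eq_sym //.
by apply: (@deglex_branch _ [::]); rewrite // !size_alternating; have [-> _ _] := hm.
Qed.

Lemma braid_rel_lead c d : (d < c)%N -> m c d != None ->
  lead (braid_rel F m c d) = altm m 0 c d.
Proof. by move=> lt_dc fin_cd; rewrite lead_monB // braid_deglex. Qed.

(** Both words are required to be below [W], since either may be the leading one. *)
Lemma braid_word_congr W A B c d : m c d != None ->
  deglex (A ++ altm m 0 c d ++ B) W -> deglex (A ++ altm m 0 d c ++ B) W ->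
  word_congr W (A ++ altm m 0 c d ++ B) (A ++ altm m 0 d c ++ B).
Proof.
wlog lt_dc : c d / (d < c)%N.
  move=> IH fin_cd lt_cd lt_dc.
  have [lt|lt|/val_inj ->] := ltngtP d c; first exact: IH.
    apply: word_congr_sym; apply: IH => //.
    by have [sym _ _] := hm; rewrite sym.
  exact: word_congr_refl.
move=> fin_cd lt_cd _.
apply: congr_mod_step lt_cd; [exact: S_braid | exact: braid_deglex].
Qed.

(** All words occurring in a chain of braid moves have the same length, so a
    prefix that forces them below [W] makes every move admissible. *)
Lemma braid_equiv_congr W P v w B : braid_equiv m v w ->
  below W P (size v + size B) -> word_congr W (P ++ v ++ B) (P ++ w ++ B).
Proof.
move=> eq_vw; elim: eq_vw P B => {v w} [v|v w eq_vw IH|v2 v1 v3 eq_12 IH1 _ IH2|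
    v v' w w' eq_v IHv eq_w IHw|c d fin_cd] P B bel.
- exact: word_congr_refl.
- by apply/word_congr_sym/IH; rewrite (braid_equiv_size hm eq_vw).
- apply: word_congr_trans (IH1 _ _ bel) (IH2 _ _ _).
  by rewrite -(braid_equiv_size hm eq_12).
- rewrite -!catA; apply: (@word_congr_trans _ (P ++ v' ++ w ++ B)).
    by apply: IHv; rewrite size_cat addnA -size_cat.
  rewrite !(catA P); apply: IHw; apply: (below_cat bel).
  by rewrite -(braid_equiv_size hm eq_v) size_cat addnA.
- have eq_size : size (altm m 0 c d) = size (altm m 0 d c).
    exact: braid_equiv_size (braid_move fin_cd).
  by apply: braid_word_congr => //; apply: bel; rewrite size_cat // eq_size.
Qed.

(** Moving [c] to the left through larger letters produces words which branch
    off [W] at [c], each time one letter earlier, so they all stay below [W]. *)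
Lemma move_letter_left W P v c B d T : W = P ++ v ++ d :: T ->
  (c < d)%N -> {in v, forall e, (c < e)%N} ->
  {in v, forall e, m e c = Some 2%N} -> (size B <= size T)%N ->
  word_congr W (P ++ v ++ c :: B) (P ++ c :: v ++ B).
Proof.
elim/last_ind: v d T B => [|v e IH] d T B eqW lt_cd lt_c com le_B.
  exact: word_congr_refl.
have v_e : e \in rcons v e by rewrite mem_rcons mem_head.
have sub_v x : x \in v -> x \in rcons v e by rewrite mem_rcons inE orbC => ->.
have com_ec := com e v_e.
apply: (@word_congr_trans _ (P ++ v ++ c :: e :: B)).
  have := @braid_word_congr W (P ++ v) B e c.
  rewrite /altm com_ec; have [-> _ _] := hm; rewrite com_ec /= cat_rcons -!catA.
  apply=> //; rewrite eqW cat_rcons 2!catA.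
    rewrite -cat_rcons -[X in deglex _ X]cat_rcons; exact: deglex_branch.
  by apply: deglex_branch; [exact: lt_c | rewrite /= ltnS].
rewrite cat_rcons; apply: (IH e (d :: T)); rewrite ?cat_rcons //.
- by rewrite eqW cat_rcons.
- exact: lt_c.
- by move=> x /sub_v; apply: lt_c.
- by move=> x /sub_v; apply: com.
Qed.

(** Only the longest word must be below [W]: each cancellation of a square
    shortens it. *)
Lemma cancel_palindrome W P v B : deglex (P ++ v ++ rev v ++ B) W ->
  word_congr W (P ++ v ++ rev v ++ B) (P ++ B).
Proof.
elim/last_ind: v => [|v c IH]; first by move=> _; apply: word_congr_refl.
rewrite rev_rcons cat_rcons /= => lt_W.
apply: (@word_congr_trans _ (P ++ v ++ rev v ++ B)); last first.
  apply/IH/deglex_short; apply: leq_trans (deglex_size lt_W).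
  by rewrite !size_cat /= !size_cat; lia.
have := @congr_mod_step F n (coxeter_S F m) W [:: c; c] [::] (P ++ v) (rev v ++ B).
rewrite mon_nil -!catA /=; apply=> //; exact: S_square.
Qed.

End Reduction.

(** * Chains *)

Section Chain.
Variables (n : nat) (m : 'I_n -> 'I_n -> option nat).
Hypothesis hm : is_coxeter_matrix m.
Implicit Types (i j l k : nat) (c : 'I_n) (s : nat -> 'I_n).

Lemma uprod_cat s (s' : nat -> 'I_n) i j l : (i <= j)%N -> (j <= l)%N ->
  uprod m s s' i l = uprod m s s' i j ++ uprod m s s' j l.
Proof. by move=> le_ij le_jl; rewrite /uprod (big_cat_nat le_ij le_jl). Qed.

Lemma uprod0 s (s' : nat -> 'I_n) i : uprod m s s' i i = [::].
Proof. by rewrite /uprod big_geq. Qed.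

Lemma uprod1 s (s' : nat -> 'I_n) i : uprod m s s' i i.+1 = uword m s s' i.
Proof. by rewrite /uprod big_nat1. Qed.

Lemma uprodSr s (s' : nat -> 'I_n) i j : (i <= j)%N ->
  uprod m s s' i j.+1 = uprod m s s' i j ++ uword m s s' j.
Proof. by move=> le_ij; rewrite (uprod_cat _ _ le_ij) // uprod1. Qed.

Lemma uprodSl s (s' : nat -> 'I_n) i j : (i < j)%N ->
  uprod m s s' i j = uword m s s' i ++ uprod m s s' i.+1 j.
Proof. by move=> lt_ij; rewrite (@uprod_cat _ _ i i.+1) // uprod1. Qed.

(** The letter standing just before [u_j] while [s'_0] is carried through the
    chain from left to right; at [j = k + 2] it has left the chain as
    [y_(k+1)]. *)
Definition carry k s (s' : nat -> 'I_n) j : 'I_n :=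
  if (j <= k.+1)%N then s' j else yletter m s s' k.+1.

Section Data.
Variables (k : nat) (s s' : nat -> 'I_n).
Hypothesis hs : chain_data m k s s'.
Local Notation U := (uprod m s s').
Local Notation u := (uword m s s').

Lemma chain_fin j : (j <= k.+1)%N -> m (s j) (s' j) != None.
Proof. by case: hs => fin _ _ _ _; apply: fin. Qed.

Lemma chain_neq j : (j <= k.+1)%N -> s j != s' j.
Proof.
case: hs => _ _ lt0 ltS _; case: j => [|j] le_j.
  by apply: contraTneq lt0 => ->; rewrite ltnn.
by apply: contraTneq (ltS j.+1 le_j) => ->; rewrite ltnn.
Qed.

Lemma yletterE j : (j <= k.+1)%N -> yletter m s s' j = braid_last m (s j) (s' j).
Proof.
by move=> le_j; rewrite /yletter altm0_rcons ?chain_neq ?chain_fin // last_rcons.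
Qed.

Lemma xletterE j : (j <= k.+1)%N -> xletter m s s' j = braid_last m (s' j) (s j).
Proof.
move=> le_j; rewrite /xletter /uword altm1_rcons ?chain_neq ?chain_fin //.
by rewrite last_rcons.
Qed.

Lemma uword_rcons j : (j <= k.+1)%N ->
  u j = rcons (altm m 2 (s j) (s' j)) (xletter m s s' j).
Proof.
by move=> le_j; rewrite xletterE // -altm1_rcons ?chain_neq ?chain_fin.
Qed.

Lemma uword_cons j : (j <= k.+1)%N -> u j = s j :: altm m 2 (s' j) (s j).
Proof. by move=> le_j; rewrite -altm1_cons ?chain_neq ?chain_fin. Qed.

Lemma chain_next j : (j <= k)%N -> s' j.+1 = yletter m s s' j.
Proof.
move=> le_j; rewrite yletterE 1?ltnW // /braid_last.
have := chain_fin (leqW le_j); case E: (m _ _) => [d|] // _.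
by case: hs => _ next _ _ _; rewrite (next _ _ le_j E).
Qed.

Lemma carryS j : (j <= k.+1)%N -> carry k s s' j.+1 = yletter m s s' j.
Proof.
rewrite /carry; case: (ltngtP j k.+1) => // [lt_j | ->] _ //.
by rewrite chain_next.
Qed.

(** The parity rule of a chain says that a letter leaving [u_j] is the one which
    can enter [u_(j+1)], so [braid_pass] can be iterated. *)
Lemma chain_pass i j : (i <= j)%N -> (j <= k.+2)%N ->
  braid_equiv m (carry k s s' i :: U i j) (rcons (U i j) (carry k s s' j)).
Proof.
elim: j => [|j IH].
  by rewrite leqn0 => /eqP -> _; rewrite uprod0; apply: braid_refl.
rewrite leq_eqVlt => /orP[/eqP -> | lt_ij] le_j.
  by rewrite uprod0; apply: braid_refl.
rewrite uprodSr // rcons_cat -cat_cons.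
apply: braid_trans (braid_catr _ (IH lt_ij (ltnW le_j))) _.
rewrite cat_rcons; apply: braid_catl; rewrite carryS // yletterE //.
rewrite /carry -ltnS le_j.
by apply: braid_pass; rewrite ?chain_neq ?chain_fin.
Qed.

Lemma chain_relE (F : fieldType) : chain_rel F m k s s' =
  mon F (rcons (U 0 k.+2) (yletter m s s' k.+1)) - mon F (s' 0%N :: U 0 k.+2).
Proof.
have -> : rcons (U 0 k.+2) (yletter m s s' k.+1) =
    U 0 k.+1 ++ altm m 0 (s k.+1) (s' k.+1).
  by rewrite altm0_rcons ?chain_neq ?chain_fin // -yletterE // -rcons_cat -uprodSr.
have -> // : s' 0%N :: U 0 k.+2 = altm m 0 (s' 0%N) (s 0%N) ++ U 1 k.+2.
by rewrite altm0_cons ?chain_neq ?chain_fin //= -uprodSl.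
Qed.

Lemma chain_deglex : deglex (s' 0%N :: U 0 k.+2)
  (rcons (U 0 k.+2) (yletter m s s' k.+1)).
Proof.
rewrite {2}uprodSl // uword_cons //= rcons_cat.
apply: (@deglex_branch _ [::]); first by case: hs.
by rewrite uprodSl // uword_cons //= !size_cat size_rcons /=; lia.
Qed.

(** The parity rule determines the second letter of each pair from the pair before
    it, so the first letter of the last pair can be replaced freely. *)
Lemma chain_truncate i c : (i <= k)%N -> (c < s' i.+1)%N ->
  m c (s' i.+1) != None -> [set s i; s' i] != [set c; s' i.+1] ->
  chain_data m i (fun j => if j == i.+1 then c else s j) s'.
Proof.
case: hs => fin next lt0 ltS neq le_i lt_c fin_c neq_c; split=> //.
- move=> j; rewrite leq_eqVlt => /orP[/eqP -> | lt_j]; first by rewrite eqxx.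
  by rewrite ltn_eqF //; apply: fin; lia.
- by move=> j d le_j; rewrite ltn_eqF //; apply: next; lia.
- move=> j le_j; case: eqP => [-> //| ne_j]; apply: ltS; lia.
- move=> j le_j; rewrite [j == _]ltn_eqF // eqSS.
  by case: (j =P i) => [-> //| ne_j]; apply: neq; lia.
Qed.

End Data.

Section Push.
Variables (k : nat) (s s' : nat -> 'I_n).
Hypothesis hs : chain_data m k s s'.
Variable F : fieldType.
Local Notation U := (uprod m s s').

(** Carrying [s'_0] through [u_0 ... u_(i-1) (m-1)(c, s'_i)] in one step, by the
    relation of the truncated chain: its leading word has the prefix
    [u_0 ... u_(i-1) c], which is assumed to be small.  For [i = 0] the chain has
    a single pair and the relation is a braid relation.  If [{c, s'_i}] is the
    pair of index [i - 1], the truncated chain is degenerate, but then the two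
    last factors cancel on both sides and the rest are shorter words. *)
Lemma chain_push W i c B : (i <= k.+1)%N -> (c < s' i)%N -> m c (s' i) != None ->
  let v := altm m 1 c (s' i) in
  below W [:: s' 0%N] (size (U 0 i) + size v + size B) ->
  below W (rcons (U 0 i) c) (size v + size B) ->
  word_congr F m W (s' 0%N :: U 0 i ++ v ++ B)
    (U 0 i ++ v ++ braid_last m c (s' i) :: B).
Proof.
move=> le_i lt_c fin_c v bel1 bel2.
have ne_c : c != s' i by apply: contraTneq lt_c => ->; rewrite ltnn.
have [sym _ _] := hm.
have vE : v = c :: altm m 2 (s' i) c by rewrite /v altm1_cons.
have lt_l : deglex (s' 0%N :: U 0 i ++ v ++ B) W.
  by apply: bel1; rewrite !size_cat addnA.
have lt_r : deglex (U 0 i ++ v ++ braid_last m c (s' i) :: B) W.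
  rewrite {1}vE /= -cat_rcons; apply: bel2.
  by rewrite vE size_cat /= -addSnnS.
case: i => [|i] in le_i lt_c fin_c v bel1 bel2 ne_c vE lt_l lt_r *.
  rewrite uprod0 /= in lt_l lt_r *.
  have := @braid_word_congr F n m hm W [::] B (s' 0%N) c.
  rewrite altm0_cons // altm0_rcons //= cat_rcons -/v; apply=> //.
  by rewrite sym.
have [eq_set | neq_set] := eqVneq [set s i; s' i] [set c; s' i.+1]; last first.
  have hs1 := chain_truncate hs (le_i : i <= k)%N lt_c fin_c neq_set.
  have S_f := S_chain F hs1; rewrite (chain_relE hs1) in S_f.
  have := @congr_mod_step F n (coxeter_S F m) W _ _ [::] B S_f (chain_deglex hs1).
  rewrite (yletterE hs1) // eqxx uprodSr // /uword eqxx -/v.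
  have -> : uprod m (fun j => if j == i.+1 then c else s j) s' 0 i.+1 = U 0 i.+1.
    by apply: eq_big_nat => j /andP[_ lt_j]; rewrite /uword ltn_eqF.
  rewrite !cat_rcons /= -!catA => step; apply/word_congr_sym/step => //.
have ne_i := chain_neq hs (ltnW le_i); have fin_i := chain_fin hs (ltnW le_i).
have nextE : s' i.+1 = braid_last m (s i) (s' i).
  by rewrite (chain_next hs) // (yletterE hs) // ltnW.
have cE : c = braid_last m (s' i) (s i).
  have : c \in [set s i; s' i] by rewrite eq_set set21.
  move: ne_c; rewrite nextE /braid_last !inE; have [-> _ _] := hm.
  case: odd => ne_c; last by rewrite (negPf ne_c) orbF => /eqP.
  by rewrite (negPf ne_c) => /eqP.
(* Hence [v] is the reversal of [u_i] ([i] is now the index of the last pair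
   kept), and [s'_i] completes it. *)
have [] := altm_rev hm ne_i fin_i; rewrite -nextE -cE -/v => v_rev last_c.
rewrite last_c v_rev in lt_l lt_r *; rewrite uprodSr // -!catA in lt_l lt_r *.
apply: (@word_congr_trans _ _ _ _ (s' 0%N :: U 0 i ++ B)).
  exact: (@cancel_palindrome F n m W (s' 0%N :: U 0 i)).
apply: (@word_congr_trans _ _ _ _ (U 0 i ++ s' i :: B)); last first.
  exact/word_congr_sym/cancel_palindrome.
have := chain_pass hs (leq0n i) (leqW (ltnW le_i)).
rewrite /carry /= (ltnW le_i) => pass; rewrite -cat_rcons.
apply: (@braid_equiv_congr F n m hm W [::] _ _ B pass).
apply: below_short; apply: leq_trans (deglex_size lt_l).
by rewrite /= !size_cat size_rev (uword_cons hs (ltnW le_i)) /=; lia.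
Qed.

End Push.
End Chain.

(** * The overlap of two consecutive factors *)

Section Overlap.
Variables (F : fieldType) (n : nat) (m : 'I_n -> 'I_n -> option nat).
Hypothesis hm : is_coxeter_matrix m.
Variables (k : nat) (s s' : nat -> 'I_n).
Hypothesis hs : chain_data m k s s'.
Local Notation U := (uprod m s s').
Local Notation u := (uword m s s').
Local Notation x := (xletter m s s').
Local Notation y := (yletter m s s').

Lemma size_uword1 j : (j <= k.+1)%N -> size (u j) = 1%N ->
  m (s j) (s' j) = Some 2%N.
Proof.
move=> le_j; have [r E] := coxeter_ge2 hm (chain_neq hs le_j) (chain_fin hs le_j).
by rewrite /uword (@altmE _ _ 1 r.+1) // size_alternating E => -[->].
Qed.

(** The last letters of [(m-1)(c, d)] and [m(c, d)] are [c] and [d] in an order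
    given by the parity of [m]. *)
Lemma xy_mem j d : (j <= k.+1)%N -> d = s j \/ d = s' j -> d = x j \/ d = y j.
Proof.
move=> le_j; rewrite (xletterE hm hs le_j) (yletterE hm hs le_j) /braid_last.
have [-> _ _] := hm.
by case: odd => -[]; auto.
Qed.

Lemma chain_rel_lead :
  lead (chain_rel F m k s s') = rcons (U 0 k.+2) (y k.+1).
Proof. by rewrite (chain_relE hm hs) lead_monB // (chain_deglex hm hs). Qed.

Lemma chain_word_split i : (i <= k)%N -> rcons (U 0 k.+2) (y k.+1) =
  (U 0 i ++ altm m 2 (s i) (s' i)) ++ [:: x i; s i.+1] ++
  (altm m 2 (s' i.+1) (s i.+1) ++ U i.+2 k.+2 ++ [:: y k.+1]).
Proof.
move=> le_i; have le_i1 := leqW le_i.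
rewrite (@uprod_cat _ _ _ _ 0 i) // 1?leqW //.
rewrite (uprodSl _ _ _ (_ : i < _)%N) 1?leqW //.
rewrite (uprodSl _ _ _ (_ : i.+1 < _)%N) //.
rewrite (uword_rcons hm hs le_i1) (uword_cons hm hs (le_i : i < k.+1)%N).
by rewrite -cats1 -!catA cat_rcons.
Qed.

Section Commuting.
Variable i : nat.
Hypothesis le_i : (i <= k)%N.
Hypothesis com_xc : m (x i) (s i.+1) = Some 2%N.
Hypothesis size1 : size (u i) = 1%N \/ size (u i.+1) = 1%N.

Let le_i1 : (i <= k.+1)%N := leqW le_i.

Lemma overlap_cases :
  [/\ u i = [:: s i], x i = s i, s' i.+1 = s' i & m (s i) (s' i) = Some 2%N] \/
  u i.+1 = [:: s i.+1] /\ m (s i.+1) (s' i.+1) = Some 2%N.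
Proof.
have [sym _ _] := hm.
case: size1 => [/(size_uword1 le_i1) E | /(size_uword1 (le_i : i < k.+1)%N) E].
  left; split=> //; first by rewrite /uword (@altmE _ _ 1 1).
    by rewrite (xletterE hm hs le_i1) /braid_last sym E.
  by rewrite (chain_next hm hs le_i) (yletterE hm hs le_i1) /braid_last E.
by right; split=> //; rewrite /uword (@altmE _ _ 1 1).
Qed.

(** If [u_i = s_i], then [s_i = x_i] commutes with [s_(i+1)] by assumption and with
    [s'_i = s'_(i+1)] because [|u_i| = 1].  If [u_(i+1) = s_(i+1)], this letter
    commutes with [x_i] by assumption and with [y_i = s'_(i+1)], and no other
    letter occurs in [u_i]. *)
Lemma overlap_commute : {in u i & u i.+1, forall d e, m d e = Some 2%N}.
Proof.
have [sym _ _] := hm.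
case: overlap_cases => [[-> eq_x eq_s' E] | [-> E]] d e.
  rewrite inE => /eqP -> /mem_alternating[] ->; last by rewrite eq_s'.
  by rewrite -eq_x.
move=> /mem_alternating /(xy_mem le_i1) d_i; rewrite inE => /eqP ->.
by case: d_i => -> //; rewrite -(chain_next hm hs le_i) sym.
Qed.

(** The truncated chain ends with the pair [(s_(i+1), s'_i)], while the chain
    itself has [(s_(i+1), s'_(i+1))].  If [|u_i| = 1] the pairs agree; if
    [|u_(i+1)| = 1] both give the one-letter factor [s_(i+1)].  In either case the
    letter coming out of the factor crosses [u_i] and becomes [y_(i+1)]: it
    commutes with the letter [u_i] in the first case, and it is [s'_i], which
    crosses by a braid relation, in the second. *)
Lemma overlap_exchange : [/\ altm m 1 (s i.+1) (s' i) = u i.+1,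
  m (s i.+1) (s' i) != None
  & braid_equiv m (braid_last m (s i.+1) (s' i) :: u i) (rcons (u i) (y i.+1))].
Proof.
have [sym _ _] := hm; rewrite (yletterE hm hs (le_i : i < k.+1)%N).
have ne_i := chain_neq hs le_i1; have fin_i := chain_fin hs le_i1.
case: overlap_cases => [[-> eq_x eq_s' E] | [ui1E E]].
  split; first by rewrite -eq_s'.
    by rewrite -eq_s'; apply: (chain_fin hs).
  rewrite -eq_s'; apply: braid_commute => //.
  case: (braid_last_mem m (s i.+1) (s' i.+1)) => ->; last by rewrite eq_s' sym.
  by rewrite -eq_x sym.
have com : m (s i.+1) (s' i) = Some 2%N.
  case: (xy_mem le_i1 (or_intror (erefl (s' i)))) => ->; first by rewrite sym.
  by rewrite -(chain_next hm hs le_i).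
split; [by rewrite ui1E (@altmE _ _ 1 1) | by rewrite com |].
rewrite /braid_last com E /= (chain_next hm hs le_i) (yletterE hm hs le_i1).
exact: braid_pass.
Qed.

Hypothesis lt_cx : (s i.+1 < x i)%N.

(** The letters [s_i], [s'_i] are [x_i] and [y_i = s'_(i+1)], both above
    [s_(i+1)]. *)
Lemma overlap_lt d : d = s i \/ d = s' i -> (s i.+1 < d)%N.
Proof.
move=> /(xy_mem le_i1) [] -> //.
by rewrite -(chain_next hm hs le_i); case: hs => _ _ _ -> //; rewrite ltnS le_i.
Qed.

(** The first move brings [c] right behind [P] and needs the finer
    [move_letter_left]; every later step takes place behind one of the small
    prefixes [P c] and [s'_0]. *)
Lemma overlap_resolved (W := rcons (U 0 k.+2) (y k.+1)) :
  word_congr F m W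
    (U 0 i ++ altm m 2 (s i) (s' i) ++ [:: s i.+1, x i
       & altm m 2 (s' i.+1) (s i.+1) ++ U i.+2 k.+2 ++ [:: y k.+1]])
    (s' 0%N :: U 0 k.+2).
Proof.
set c := s i.+1; set P := U 0 i; set R := U i.+2 k.+2.
set V := altm m 2 (s i) (s' i); set V' := altm m 2 (s' i.+1) c.
have UE : U 0 k.+2 = P ++ u i ++ u i.+1 ++ R.
  rewrite (@uprod_cat _ _ _ _ 0 i) // 1?leqW //.
  rewrite (uprodSl _ _ _ (_ : i < _)%N) 1?leqW //.
  by rewrite (uprodSl _ _ _ (_ : i.+1 < _)%N).
have uiE : u i = rcons V (x i) by apply: (uword_rcons hm hs).
have uiE' : u i = s i :: altm m 2 (s' i) (s i) by apply: (uword_cons hm hs).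
have ui1E : u i.+1 = c :: V' by rewrite (uword_cons hm hs).
have com := overlap_commute; have lt_c := overlap_lt.
have WE : W = P ++ V ++ x i :: (c :: V' ++ R ++ [:: y k.+1]).
  by rewrite /W (chain_word_split le_i) -catA.
(* [W] starts with [s_0 > s'_0] and with [P s_i], where [s_i > c]. *)
have bel1 : below W [:: s' 0%N] (size (U 0 k.+2)).
  rewrite /W uprodSl // (uword_cons hm hs) // rcons_cat /=.
  apply: (@below_branch _ [::]); first by case: hs.
  by rewrite !size_cat size_rcons; lia.
have bel2 : below W (rcons P c) (size (u i ++ u i.+1 ++ R)).
  rewrite /W UE rcons_cat uiE' /=; apply: below_branch; first by apply: lt_c; left.
  by rewrite size_rcons.
apply: (@word_congr_trans _ _ _ _ (P ++ u i.+1 ++ u i ++ R ++ [:: y k.+1])).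
  apply: (@word_congr_trans _ _ _ _ (P ++ c :: V ++ x i :: V' ++ R ++ [:: y k.+1])).
    apply: (move_letter_left F hm WE) => //.
    - by move=> d /mem_alternating; apply: lt_c.
    - move=> d V_d; apply: com; rewrite ?uiE ?ui1E ?mem_head //.
      by rewrite mem_rcons inE V_d orbT.
  rewrite -[V ++ x i :: _]cat_rcons -uiE.
  have := @braid_equiv_congr F n m hm W (rcons P c) (u i ++ V') (V' ++ u i)
    (R ++ [:: y k.+1]).
  rewrite !cat_rcons ui1E -!catA; apply.
    apply: braid_commute_words => // d e u_d V_e.
    by apply: com; rewrite // ui1E inE V_e orbT.
  by apply: (below_le bel2); rewrite ui1E uiE !size_cat /=; lia.
(* Both sides meet at [P u_(i+1) u_i R y_(k+1)]; from here on, the other word. *)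
apply: word_congr_sym.
apply: (@word_congr_trans _ _ _ _ (s' 0%N :: P ++ u i.+1 ++ u i ++ R)).
  have := @braid_equiv_congr F n m hm W (s' 0%N :: P) _ _ R
    (braid_commute_words hm com).
  rewrite UE /= -!catA; apply; apply: (below_cat (P := [:: s' 0%N]) bel1).
  by rewrite UE !size_cat; lia.
have [alt_c fin_c exch] := overlap_exchange.
apply: (@word_congr_trans _ _ _ _
    (P ++ u i.+1 ++ braid_last m c (s' i) :: u i ++ R)).
  rewrite -alt_c; apply: (chain_push hm hs) => //.
  - by apply: lt_c; right.
  - by apply: (below_le bel1); rewrite UE alt_c !size_cat -/P; lia.
  - by apply: (below_le bel2); rewrite alt_c !size_cat; lia.
apply: (@word_congr_trans _ _ _ _ (P ++ u i.+1 ++ u i ++ y i.+1 :: R)).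
  have := @braid_equiv_congr F n m hm W (P ++ u i.+1) _ _ R exch.
  rewrite cat_rcons -!catA; apply; rewrite ui1E -cat_rcons.
  by apply: (below_cat bel2); rewrite ui1E !size_cat /=; lia.
have := chain_pass hm hs (_ : i.+2 <= k.+2)%N (leqnn _).
rewrite (carryS hm hs) // (carryS hm hs) // -/R => /(_ le_i) pass.
have := @braid_equiv_congr F n m hm W (P ++ u i.+1 ++ u i) _ _ [::] pass.
rewrite !cats0 -cats1 -!catA; apply; rewrite addn0 ui1E /= -cat_rcons.
by apply: (below_cat bel2); rewrite ui1E !size_cat /=; lia.
Qed.

End Commuting.
End Overlap.

(** * The theorem *)

Lemma cat_inj_context (T : eqType) (a b v w : seq T) :
  a ++ v ++ b = a ++ w ++ b -> v = w.
Proof.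
move/eqP; rewrite eqseq_cat // eqxx andTb => /eqP eq_b.
have := congr1 size eq_b; rewrite !size_cat => /addIn size_eq.
by move/eqP: eq_b; rewrite eqseq_cat // eqxx andbT => /eqP.
Qed.

(** An inclusion composition of two binomials just rewrites the first word. *)
Lemma inclusion_composition_mon (F : fieldType) (n : nat) (p q r a b : word n) :
  inclusion_composition (mon F (a ++ p ++ b) - mon F q) (mon F p - mon F r) a b =
  mon F (a ++ r ++ b) - mon F q.
Proof.
by rewrite /inclusion_composition mulrB_sandwich -!mon_cat subrBB_cancel.
Qed.

Theorem theorem3p17 (F : fieldType) (n : nat)
    (m : 'I_n -> 'I_n -> option nat) (hm : is_coxeter_matrix m)
    (k : nat) (s s' : nat -> 'I_n) (hs : chain_data m k s s')
    (t t' : 'I_n) (htt' : (t' < t)%N) (hfin : m t t' != None)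
    (i : nat) (hi : (i <= k)%N) :
  let f := chain_rel F m k s s' in
  let g := braid_rel F m t t' in
  let u := uword m s s' in
  let x := xletter m s s' in
  let y := yletter m s s' in
  let a := uprod m s s' 0 i ++ altm m 2 (s i) (s' i) in
  let b := altm m 2 (s' i.+1) (s i.+1)
             ++ uprod m s s' i.+2 k.+2 ++ [:: y k.+1] in
  lead f = a ++ lead g ++ b ->
  [/\ g = mon F [:: x i; s i.+1] - mon F [:: s i.+1; x i]
        /\ (s i.+1 < x i)%N,
      size (u i) = 1%N \/ size (u i.+1) = 1%N ->
        congr_mod (coxeter_S F m) (lead f)
          (inclusion_composition f g a b) 0
    & (1 < size (u i))%N -> (1 < size (u i.+1))%N ->
        congr_mod (coxeter_S F m) (lead f)
          (inclusion_composition f g a b)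
          (mon F (a ++ [:: s i.+1; x i] ++ b)
           - mon F (s' 0%N :: uprod m s s' 0 k.+2))].
Proof.
move=> f g u x y a b lead_f.
have [sym _ _] := hm; pose W := rcons (uprod m s s' 0 k.+2) (y k.+1).
have WE : W = a ++ [:: x i; s i.+1] ++ b := chain_word_split hm hs hi.
have fE : f = mon F W - mon F (s' 0%N :: uprod m s s' 0 k.+2).
  exact: (chain_relE hm hs).
have lead_fE : lead f = W := chain_rel_lead F hm hs.
have gE : g = mon F (altm m 0 t t') - mon F (altm m 0 t' t) := erefl.
have lead_gE : lead g = altm m 0 t t' := braid_rel_lead F hm htt' hfin.
(* From here on only the expressions of [f] and [g] as binomials matter. *)
clearbody f g.
have altE : altm m 0 t t' = [:: x i; s i.+1].
  by apply: (@cat_inj_context _ a b); rewrite -lead_gE -lead_f lead_fE.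
have [E eq_t eq_t'] := altm0_pair altE.
have altE' : altm m 0 t' t = [:: s i.+1; x i].
  by rewrite (@altmE _ _ 0 2) 1?sym // -eq_t -eq_t'.
have lt_cx : (s i.+1 < x i)%N by rewrite -eq_t -eq_t'.
rewrite altE altE' in gE.
have fgE : inclusion_composition f g a b =
    mon F (a ++ [:: s i.+1; x i] ++ b) - mon F (s' 0%N :: uprod m s s' 0 k.+2).
  by rewrite gE fE WE; apply: inclusion_composition_mon.
split; [by split | move=> size1 | move=> _ _].
  have com : m (x i) (s i.+1) = Some 2%N by rewrite -eq_t -eq_t'.
  have := overlap_resolved F hm hs hi com size1 lt_cx.
  by rewrite fgE lead_fE -catA; apply: congr_mod_subr0.
by rewrite fgE; apply: congr_mod_refl.
Qed.
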